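(* Let $D$ be a probability distribution on a finite set $\Omega$ with $m=\log|\Omega|\ge2$, and let $\varepsilon>0$, $\delta\in(0,1)$. Given access to $\mathsf{PROC}$ for $D$, the algorithm $\mathsf{EntropyEstimation}(\varepsilon,\delta)$ returns $\hat h$ satisfying $$\Pr\big[(1-\varepsilon)H(D)\le\hat h\le(1+\varepsilon)H(D)\big]\ge1-\delta,$$ where $H(D)=\sum_{x\in\Omega}D(x)\log\frac1{D(x)}$ is the Shannon entropy.
   Context: All logarithms are base 2, with $0\log\frac10=0$. A probability-revealing conditional sampling oracle $\mathsf{PROC}$ for $D$, on query $S\subseteq\Omega$ with $D(S)>0$, returns a pair $(x,D(x))$ where $x\in S$ is drawn with probability $D(x)/\sum_{y\in S}D(y)$, independently across queries (it returns the unconditional probability $D(x)$). The subroutine $\mathsf{SampleEst}(\bar S,t,\delta')$: set $T=\lceil\frac92\log\frac2{\delta'}\rceil$; for $i=1,\dots,T$, make $t$ queries $\mathsf{PROC}(\Omega\setminus\bar S)$ obtaining $(y_{ij},r_{ij})_{j\le t}$ and let $C_i=\frac1t\sum_{j=1}^t\log\frac1{r_{ij}}$; return the median of $C_1,\dots,C_T$. The algorithm $\mathsf{EntropyEstimation}(\varepsilon,\delta)$: for $i=1,\dots,\lceil\log(10/\delta)\rceil$: query $(x,r)\gets\mathsf{PROC}(\Omega)$; if $r>1/2$, set $t=\lceil\frac6{\varepsilon^2}(m+\log(m+\log m+2.5))\rceil$, compute $\hat h_{rem}=\mathsf{SampleEst}(\{x\},t,0.9\delta)$, and return $\hat h=(1-r)\hat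 h_{rem}+r\log\frac1r$ (provided $r<1$; if $r=1$ return $0$). If no round has $r>1/2$, set $t=\lceil\frac6{\varepsilon^2}(m+\log(m+\log m+1.1)-1)\rceil$ and return $\hat h=\mathsf{SampleEst}(\varnothing,t,0.9\delta)$. *)

(* Defs.v *)
From mathcomp Require Import all_boot all_order all_algebra.
From mathcomp Require Import all_classical all_reals.
From mathcomp Require Import exp.
Set Implicit Arguments. Unset Strict Implicit. Unset Printing Implicit Defensive.
Import Order.TTheory GRing.Theory Num.Theory.
Local Open Scope ring_scope.

(* Randomized computations are given their exact output law through the
   expectation (continuation) monad: a computation returning values of type
   A is represented by  (A -> R) -> R , mapping a test function k to the
   expected value E[k(output)].  The probability of an event is the
   expectation of its indicator. *)

Section Algo.
Variables (R : realType) (Omega : finType) (D : Omega -> R).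

Definition log2 (x : R) : R := ln x / ln 2.

(* nat ceiling (applied only to positive arguments) *)
Definition ceilN (x : R) : nat := `|Num.ceil x|%N.

Definition entropy : R :=
  \sum_(x : Omega) (if D x == 0 then 0 else D x * log2 (1 / D x)).

(* PROC(S): draws x in S with probability D(x)/D(S), reveals (x, D(x)) *)
Definition PROC (S : {set Omega}) (k : Omega -> R -> R) : R :=
  \sum_(x in S) (D x / \sum_(y in S) D y) * k x (D x).

Fixpoint sumLogQueries (S : {set Omega}) (t : nat) (k : R -> R) : R :=
  match t with
  | 0 => k 0
  | t'.+1 => PROC S (fun _ r => sumLogQueries S t' (fun s => k (log2 (1 / r) + s)))
  end.

Fixpoint repeatC (S : {set Omega}) (t T : nat) (k : seq R -> R) : R :=
  match T with
  | 0 => k [::]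
  | T'.+1 => sumLogQueries S t (fun s =>
               repeatC S t T' (fun cs => k ((s / t%:R) :: cs)))
  end.

Definition median (s : seq R) : R :=
  nth 0 (sort <=%R s) ((size s).-1./2).

Definition SampleEst (Sbar : {set Omega}) (t : nat) (delta' : R)
    (k : R -> R) : R :=
  let T := ceilN (9 / 2 * log2 (2 / delta')) in
  repeatC (~: Sbar) t T (fun cs => k (median cs)).

Definition mOmega : R := log2 #|Omega|%:R.

Definition heavyBranch (eps delta : R) (x : Omega) (r : R) (k : R -> R) : R :=
  let m := mOmega in
  if r == 1 then k 0 else
  let t := ceilN (6 / eps ^+ 2 * (m + log2 (m + log2 m + 5 / 2))) in
  SampleEst [set x] t (9 / 10 * delta)
    (fun hrem => k ((1 - r) * hrem + r * log2 (1 / r))).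

Definition lightBranch (eps delta : R) (k : R -> R) : R :=
  let m := mOmega in
  let t := ceilN (6 / eps ^+ 2 * (m + log2 (m + log2 m + 11 / 10) - 1)) in
  SampleEst (finset.set0) t (9 / 10 * delta) k.

Fixpoint rounds (eps delta : R) (n : nat) (k : R -> R) : R :=
  match n with
  | 0 => lightBranch eps delta k
  | n'.+1 => PROC [set: Omega] (fun x r =>
               if 1 / 2 < r then heavyBranch eps delta x r k
               else rounds eps delta n' k)
  end.

Definition EntropyEstimation (eps delta : R) (k : R -> R) : R :=
  rounds eps delta (ceilN (log2 (10 / delta))) k.

Definition PrEE (eps delta : R) (P : R -> bool) : R :=
  EntropyEstimation eps delta (fun h => if P h then 1 else 0).

End Algo.

(* Main.v *)
Require Import Defs.
From mathcomp Require Import all_boot all_order all_algebra.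
From mathcomp Require Import all_classical all_reals.
From mathcomp Require Import exp.
From mathcomp Require Import ring lra zify.
Import Order.TTheory GRing.Theory Num.Theory.
Local Open Scope ring_scope.
Set Implicit Arguments.
Unset Strict Implicit.

(** Let [X = log2 (1 / D x)] be the surprisal of a sample.  Surprisals above
    [L = m + log2 A], with [A = m + log2 m + 11 / 10] or [m + log2 m + 5 / 2],
    belong to points of mass below [1 / (#|Omega| A)], and contribute at most
    [(3 / 4 L + 9 / 4) / A] to [E[X (X - L)]]; hence
    [E[X^2] <= L E[X] + (3 / 4 L + 9 / 4) / A].
    If no point is heavier than [1 / 2] then [H >= 1] and
    [Var X <= 36 / 25 (L - 1) H^2].  If [x] has mass [r > 1 / 2], the same bound
    for the distribution conditioned on avoiding [x] applies because the
    variance is unchanged by the shift [log2 (1 / (1 - r)) >= 1], and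
    [(1 - r)^2 Var X <= 36 / 25 L H^2].  So each average [C_i] fails with
    probability at most [6 / 25], and the median of [T] of them with probability
    at most [(6 / 7)^T <= delta' / 2].  A heavy point is missed by all the
    rounds with probability at most [delta / 10]. *)

(** * Logarithms *)

(** The tangent bound at [14 / 15] gives [ln (15 / 14) >= 1 / 15], and [(15 / 14) ^+ 10] is just
    below [2]. *)
Lemma ln2_ge (R : realType) : 2 / 3 <= ln 2 :> R.
Proof.
have h : 1 / 15 <= ln (15 / 14) :> R.
  have -> : 15 / 14 = (14 / 15 : R)^-1 by field.
  rewrite lnV ?posrE ?divr_gt0//.
  have := @le_ln1Dx R (- (1 / 15)).
  have -> : 1 + - (1 / 15) = 14 / 15 :> R by field.
  by move=> /(_ ltac:(lra)); lra.
have : ln ((15 / 14) ^+ 10) <= ln 2 :> R.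
  by rewrite ler_ln ?posrE ?exprn_gt0 ?divr_gt0//; lra.
by rewrite lnXn ?divr_gt0// -[ln _ *+ _]mulr_natr; lra.
Qed.

Lemma ln2_gt0 (R : realType) : 0 < ln 2 :> R.
Proof. by have := @ln2_ge R; lra. Qed.

Lemma log2M (R : realType) (x y : R) :
  0 < x -> 0 < y -> log2 (x * y) = log2 x + log2 y.
Proof. by move=> x0 y0; rewrite /log2 lnM ?posrE// mulrDl. Qed.

Lemma log2V (R : realType) (x : R) : 0 < x -> log2 (1 / x) = - log2 x.
Proof. by move=> x0; rewrite /log2 div1r lnV ?posrE// mulNr. Qed.

Lemma ler_log2 (R : realType) (x y : R) :
  0 < x -> x <= y -> log2 x <= log2 y.
Proof.
move=> x0 xy; have y0 : 0 < y by exact: lt_le_trans xy.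
by rewrite /log2 ler_pM2r ?invr_gt0 ?ln2_gt0// ler_ln ?posrE.
Qed.

Lemma log2_exp2 (R : realType) (n : nat) : log2 (2 ^+ n) = n%:R :> R.
Proof.
by rewrite /log2 lnXn// -[X in X / _]mulr_natl mulfK// gt_eqF// ln2_gt0.
Qed.

Lemma log2_1 (R : realType) : log2 1 = 0 :> R.
Proof. exact: (log2_exp2 R 0). Qed.

Lemma log2_2 (R : realType) : log2 2 = 1 :> R.
Proof. exact: (log2_exp2 R 1). Qed.

Lemma log2_4 (R : realType) : log2 4 = 2 :> R.
Proof. by rewrite -(log2_exp2 R 2); congr log2; ring. Qed.

Lemma log2_ge0 (R : realType) (x : R) : 1 <= x -> 0 <= log2 x.
Proof. by move=> x1; rewrite -(log2_1 R) ler_log2. Qed.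

(** Split off [ln 2 <= 1] and bound [ln (z / 2)] by its tangent [z / 2 - 1]. *)
Lemma ln_le_half (R : realType) (z : R) : 0 < z -> ln z <= z / 2.
Proof.
move=> z0.
have -> : ln z = ln 2 + ln (z / 2).
  by rewrite -lnM ?posrE ?divr_gt0//; congr ln; field.
have h2 : ln 2 <= 1 :> R.
  by have := @le_ln1Dx R 1; rewrite (_ : 1 + 1 = 2)//; apply; lra.
have := @le_ln1Dx R (z / 2 - 1); rewrite addrCA subrr addr0.
move=> /(_ ltac:(lra)).
lra.
Qed.

Lemma log2_le_linear (R : realType) (z : R) : 1 <= z -> log2 z <= 3 / 4 * z.
Proof.
move=> z1; rewrite /log2 ler_pdivrMr ?ln2_gt0//.
have := @ln2_ge R; have : ln z <= z / 2 by apply: ln_le_half; lra.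
by nra.
Qed.

(** [ln_le_half] at [Num.sqrt z] gives [ln z <= Num.sqrt z]; square this and divide by
    [ln 2 ^+ 2 >= 4 / 9]. *)
Lemma sqr_log2_le_linear (R : realType) (z : R) :
  1 <= z -> log2 z ^+ 2 <= 9 / 4 * z.
Proof.
move=> z1.
have sz : Num.sqrt z ^+ 2 = z by rewrite sqr_sqrtr//; lra.
have s0 : 0 < Num.sqrt z by rewrite sqrtr_gt0; lra.
have l0 : 0 <= ln z by exact: ln_ge0.
have ls : ln z <= Num.sqrt z.
  by rewrite -{1}sz lnXn// mulr2n; have := @ln_le_half R _ s0; lra.
have l2 : ln z ^+ 2 <= z.
  by rewrite -[leRHS]sz ler_pXn2r// nnegrE// ltW.
rewrite /log2 expr_div_n ler_pdivrMr ?exprn_gt0 ?ln2_gt0//.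
have h : 4 / 9 <= ln 2 ^+ 2 :> R by have := @ln2_ge R; nra.
by nra.
Qed.

Lemma ceilN_ge (R : realType) (x : R) : 0 <= x -> x <= (Defs.ceilN x)%:R.
Proof.
move=> x0; rewrite /Defs.ceilN -[leRHS]mulrz_nat natz gez0_abs ?ceil_ge//.
by rewrite ceil_ge0; lra.
Qed.

(** * The sampling monad *)

Lemma PROC_mono (R : realType) (Omega : finType) (D : Omega -> R)
    (S : {set Omega}) (k1 k2 : Omega -> R -> R) :
  (forall x, 0 <= D x) -> (forall x, k1 x (D x) <= k2 x (D x)) ->
  PROC D S k1 <= PROC D S k2.
Proof.
move=> D0 k12; apply: ler_sum => x _.
by rewrite ler_wpM2l// divr_ge0// sumr_ge0.
Qed.

Lemma sum_cond_prob (R : realType) (Omega : finType) (D : Omega -> R)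
    (S : {set Omega}) :
  0 < \sum_(y in S) D y -> \sum_(x in S) (D x / \sum_(y in S) D y) = 1.
Proof. by move=> DS; rewrite -mulr_suml divff// gt_eqF. Qed.

Lemma sumLogQueries_mono (R : realType) (Omega : finType) (D : Omega -> R)
    (S : {set Omega}) (t : nat) (k1 k2 : R -> R) :
  (forall x, 0 <= D x) -> (forall s, k1 s <= k2 s) ->
  sumLogQueries D S t k1 <= sumLogQueries D S t k2.
Proof.
move=> D0; elim: t k1 k2 => [|t IH] k1 k2 k12 //=.
by apply: PROC_mono => // x; apply: IH.
Qed.

Lemma sumLogQueries_affine (R : realType) (Omega : finType) (D : Omega -> R)
    (S : {set Omega}) (t : nat) (k : R -> R) (a b : R) :
  0 < \sum_(y in S) D y ->
  sumLogQueries D S t (fun s => a + b * k s) = a + b * sumLogQueries D S t k.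
Proof.
move=> DS; elim: t k => [//|t IH] k /=.
rewrite /PROC; under eq_bigr => x _ do rewrite IH mulrDr mulrCA.
by rewrite big_split/= -mulr_suml sum_cond_prob// mul1r -mulr_sumr.
Qed.

Lemma repeatC_mono (R : realType) (Omega : finType) (D : Omega -> R)
    (S : {set Omega}) (t T : nat) (k1 k2 : seq R -> R) :
  (forall x, 0 <= D x) -> (forall cs, size cs = T -> k1 cs <= k2 cs) ->
  repeatC D S t T k1 <= repeatC D S t T k2.
Proof.
move=> D0; elim: T k1 k2 => [|T IH] k1 k2 k12 /=; first exact: k12.
apply: sumLogQueries_mono => // s; apply: IH => cs sz.
by apply: k12; rewrite /= sz.
Qed.

(** Independence turns the expected product into a power. The coefficient [a] is kept general so
    that the induction can absorb the factor of the first estimate. *)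
Lemma repeatC_prod (R : realType) (Omega : finType) (D : Omega -> R)
    (S : {set Omega}) (t T : nat) (f : R -> R) (a : R) :
  0 < \sum_(y in S) D y ->
  repeatC D S t T (fun cs => 1 - a * \prod_(c <- cs) f c) =
  1 - a * sumLogQueries D S t (fun s => f (s / t%:R)) ^+ T.
Proof.
move=> DS; elim: T a => [|T IH] a /=; first by rewrite big_nil expr0.
set E := sumLogQueries D S t (fun s => f (s / t%:R)).
transitivity (sumLogQueries D S t
    (fun s => 1 + (- (a * E ^+ T)) * f (s / t%:R))).
  congr sumLogQueries; apply/funext => s.
  under [X in repeatC _ _ _ _ X]funext => cs do rewrite big_cons mulrA.
  by rewrite IH mulNr mulrAC.
by rewrite (sumLogQueries_affine _ (fun s => f (s / t%:R)))//
  exprSr mulrA mulNr.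
Qed.

(** The weights are conditional on [S], but the surprisal is that of the unconditional mass, which
    is what [PROC] reveals. *)
Definition procMean {R : realType} {Omega : finType} (D : Omega -> R)
    (S : {set Omega}) : R :=
  \sum_(x in S) (D x / \sum_(y in S) D y) * log2 (1 / D x).

Definition procVar {R : realType} {Omega : finType} (D : Omega -> R)
    (S : {set Omega}) : R :=
  \sum_(x in S) (D x / \sum_(y in S) D y) *
    (log2 (1 / D x) - procMean D S) ^+ 2.

(** Variances of independent draws add up. The offset [a] carries the deviations of the earlier
    draws through the induction; its cross term vanishes because a centred draw has mean zero. *)
Lemma sumLogQueries_sqr (R : realType) (Omega : finType) (D : Omega -> R)
    (S : {set Omega}) (t : nat) (a : R) :
  0 < \sum_(y in S) D y ->
  sumLogQueries D S t (fun s => (s - t%:R * procMean D S + a) ^+ 2) =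
  t%:R * procVar D S + a ^+ 2.
Proof.
move=> DS; elim: t a => [|t IH] a /=; first by rewrite !mul0r subr0 !add0r.
set mu := procMean D S in IH *; set V := procVar D S in IH *.
rewrite /PROC.
pose w x := D x / \sum_(y in S) D y.
transitivity (\sum_(x in S) (w x * (t%:R * V + a ^+ 2 - 2 * a * mu) +
    (w x * (log2 (1 / D x) - mu) ^+ 2 + w x * log2 (1 / D x) * (2 * a)))).
  apply: eq_bigr => x _; rewrite -/(w x).
  under [X in sumLogQueries _ _ _ X]funext => s.
    have -> : log2 (1 / D x) + s - t.+1%:R * mu + a =
      s - t%:R * mu + (log2 (1 / D x) - mu + a) by rewrite -natr1; ring.
    over.
  by rewrite IH; ring.
have sw : \sum_(x in S) w x = 1 by exact: sum_cond_prob.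
rewrite !big_split/= -mulr_suml sw.
have -> : \sum_(x in S) w x * log2 (1 / D x) * (2 * a) = mu * (2 * a).
  by rewrite -mulr_suml.
by rewrite -/(procVar D S) -/V -natr1; ring.
Qed.

(** * Median amplification *)

(** In sorted order, with [i] the median index, a median below [lo] makes the first [i.+1] entries
    bad, and one above [hi] makes the last [size s - i] bad; either is at least half of the list. *)
Lemma median_good (R : realType) (s : seq R) (lo hi : R) :
  (0 < size s)%N ->
  (2 * count (fun c => ~~ ((lo <= c) && (c <= hi))%R) s < size s)%N ->
  (lo <= median s) && (median s <= hi).
Proof.
move=> s0; set bad := (X in count X); apply: contraTT; rewrite -leqNgt => hm.
set s' := sort <=%R s; set i := ((size s).-1./2)%N.
have szs : size s' = size s by rewrite size_sort.
have srt : sorted <=%R s' by apply: sort_sorted; apply: le_total.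
have lei : (i < size s)%N by rewrite /i; lia.
have iup : (size s <= 2 * i.+1)%N by rewrite /i; lia.
have idn : (size s <= 2 * (size s - i))%N by rewrite /i; lia.
have nthle j k : (j <= k)%N -> (k < size s)%N -> nth 0 s' j <= nth 0 s' k.
  move=> jk ks; apply: (sorted_leq_nth le_trans lexx 0 srt) => //;
  by rewrite inE szs// (leq_ltn_trans jk).
have -> : count bad s = count bad s' by apply/permP; rewrite perm_sym perm_sort.
move: hm; rewrite negb_and -!ltNge => /orP[hlo|hhi].
- apply: leq_trans iup _; rewrite leq_mul2l/=.
  rewrite -(cat_take_drop i.+1 s') count_cat.
  have /eqP -> : count bad (take i.+1 s') == i.+1.
    rewrite -{2}(@size_takel i.+1 _ s') ?szs// -all_count.
    apply/(all_nthP 0) => j; rewrite size_takel ?szs// => ji.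
    rewrite nth_take// /bad negb_and -!ltNge (le_lt_trans _ hlo)//.
    by apply: nthle.
  exact: leq_addr.
- apply: leq_trans idn _; rewrite leq_mul2l/=.
  rewrite -(cat_take_drop i s') count_cat.
  have /eqP -> : count bad (drop i s') == (size s - i)%N.
    rewrite -szs -size_drop -all_count.
    apply/(all_nthP 0) => j; rewrite size_drop szs => ji.
    rewrite nth_drop /bad negb_and -!ltNge (lt_le_trans hhi) ?orbT//.
    by apply: nthle; rewrite ?leq_addr// -ltn_subRL.
  exact: leq_addl.
Qed.

(** Bad entries contribute at least [l] and the others at least [l^-1], so the product is at least
    [l] to the power twice the bad count minus the size. *)
Lemma prod_ge1_of_count (R : realType) (f : R -> R) (bad : pred R) (l : R)
    (s : seq R) :
  1 <= l -> (forall c, l^-1 <= f c) -> (forall c, bad c -> l <= f c) ->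
  (size s <= 2 * count bad s)%N -> 1 <= \prod_(c <- s) f c.
Proof.
move=> l1 f1 f2; have l0 : 0 < l by lra.
move=> hs; apply: (@le_trans _ _ (l ^+ (2 * count bad s) / l ^+ size s)).
  by rewrite ler_pdivlMr ?exprn_gt0// mul1r ler_weXn2l.
elim: s {hs} => [|c s IH] /=; first by rewrite big_nil expr0 divr1.
rewrite big_cons.
have -> : l ^+ (2 * (bad c + count bad s)) / l ^+ (size s).+1 =
  (l ^+ (2 * bad c) / l) * (l ^+ (2 * count bad s) / l ^+ size s).
  rewrite mulnDr exprD exprS invfM; ring.
apply: ler_pM => //; try by rewrite divr_ge0 ?exprn_ge0// ltW.
case: (boolP (bad c)) => [/f2|_]; last by rewrite muln0 expr0 div1r.
by rewrite muln1 expr2 mulfK// gt_eqF.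
Qed.

(** In logarithms, [9 * ln rho <= - 2 * ln 2], which exactly offsets the factor [9 / 2] in the
    number of repetitions. *)
Lemma expr_log2_decay (R : realType) (rho d : R) (T : nat) :
  0 < rho -> rho ^+ 9 <= 1 / 4 -> 0 < d ->
  9 / 2 * log2 (2 / d) <= T%:R -> rho ^+ T <= d / 2.
Proof.
move=> r0 r9 d0; rewrite /log2 => hT; have l2 := @ln2_gt0 R.
have d20 : 0 < d / 2 by lra.
have -> : d / 2 = (2 / d)^-1 by rewrite invf_div.
rewrite -ler_ln ?posrE ?invr_gt0 ?divr_gt0 ?exprn_gt0// lnXn//.
rewrite lnV ?posrE ?divr_gt0//.
rewrite -[ln _ *+ _]mulr_natr.
have : ln (rho ^+ 9) <= ln (1 / 4).
  by rewrite ler_ln ?posrE ?exprn_gt0 ?divr_gt0.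
have -> : 1 / 4 = (2 ^+ 2)^-1 :> R by field.
rewrite lnV ?posrE ?exprn_gt0// !lnXn//.
rewrite -[ln rho *+ _]mulr_natr -[ln 2 *+ _]mulr_natr => h.
have hT2 : 9 / 2 * ln (2 / d) <= T%:R * ln 2.
  by move: hT; rewrite mulrA ler_pdivrMr.
have T0 : 0 <= T%:R :> R by exact: ler0n.
nra.
Qed.

(* The per-estimate failure probability is allowed to be [6 / 25] rather than
   the [1 / 6] of the paper.  The indicator of "at least half of the estimates
   are bad" is dominated by the product over the estimates of
   [5 / 9 + (9 / 5 - 5 / 9) * ((c - mu) / B) ^+ 2]: each factor is at least
   [5 / 9], and at least [9 / 5] when [c] is bad.  This performs the Chebyshev
   and Chernoff steps at once. *)
Lemma SampleEst_correct (R : realType) (Omega : finType) (D : Omega -> R)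
    (Sbar : {set Omega}) (t : nat) (d B : R) (P : R -> bool) :
  (forall x, 0 <= D x) -> 0 < \sum_(y in ~: Sbar) D y -> (0 < t)%N ->
  0 < d -> d < 1 -> 0 < B ->
  procVar D (~: Sbar) <= 6 / 25 * t%:R * B ^+ 2 ->
  (forall h, procMean D (~: Sbar) - B <= h <= procMean D (~: Sbar) + B ->
    P h) ->
  1 - d <= SampleEst D Sbar t d (fun h => if P h then 1 else 0).
Proof.
move=> D0 DS t0 d0 d1 B0 hV hP; rewrite /SampleEst.
have dle : d / 2 <= d by lra.
have l1 : 1 <= 9 / 5 :> R by lra.
set T := Defs.ceilN _; set S := ~: Sbar in DS hV hP *.
set mu := procMean D S in hP *.
have lg : 0 < 9 / 2 * log2 (2 / d).
  rewrite mulr_gt0// ?divr_gt0// ?ln2_gt0// ln_gt0// ltr_pdivlMr//; lra.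
have hT : 9 / 2 * log2 (2 / d) <= T%:R by apply: ceilN_ge; exact: ltW.
have T0 : (0 < T)%N by rewrite -(ltr_nat R); apply: lt_le_trans hT.
have tR : 0 < t%:R :> R by rewrite ltr0n.
pose f c : R := 5 / 9 + 56 / 45 * ((c - mu) / B) ^+ 2.
pose bad c := ~~ ((mu - B <= c) && (c <= mu + B)).
have f1 c : (9 / 5)^-1 <= f c.
  by rewrite /f invf_div lerDl mulr_ge0 ?divr_ge0 ?sqr_ge0.
have f2 c : bad c -> 9 / 5 <= f c.
  rewrite /bad negb_and -!ltNge => hb; rewrite /f expr_div_n.
  have h : 1 <= (c - mu) ^+ 2 / B ^+ 2.
    rewrite ler_pdivlMr ?exprn_gt0// mul1r.
    by case/orP: hb => hb; nra.
  lra.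
set E := sumLogQueries D S t (fun s => f (s / t%:R)).
have hE : E = 5 / 9 + 56 / 45 * (procVar D S / (t%:R * B ^+ 2)).
  have := sumLogQueries_sqr t 0 DS; rewrite -/mu => hq.
  transitivity (sumLogQueries D S t (fun s =>
     5 / 9 + (56 / 45 / (t%:R * B) ^+ 2) * (s - t%:R * mu + 0) ^+ 2)).
    rewrite /E; congr sumLogQueries; apply/funext => s; rewrite /f.
    by field; rewrite !gt_eqF.
  rewrite sumLogQueries_affine// hq.
  by field; rewrite !gt_eqF.
have V0 : 0 <= procVar D S.
  by apply: sumr_ge0 => x _; rewrite mulr_ge0 ?sqr_ge0 ?divr_ge0 ?sumr_ge0.
have hEle : E <= 5 / 9 + 56 / 45 * (6 / 25).
  rewrite hE lerD2l ler_wpM2l// ?divr_ge0// ler_pdivrMr ?mulr_gt0 ?exprn_gt0//.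
  by rewrite mulrA.
have E0 : 0 <= E.
  have : 0 <= procVar D S / (t%:R * B ^+ 2).
    by rewrite divr_ge0// mulr_ge0 ?sqr_ge0// ltW.
  by rewrite hE; lra.
(* Numerically [5 / 9 + 56 / 45 * (6 / 25)] is about [0.8542], below [6 / 7], and [(6 / 7) ^+ 9] is
   about [0.2497], barely below [1 / 4]. *)
have hET : E ^+ T <= d / 2.
  apply: (@le_trans _ _ ((6 / 7) ^+ T)).
    by rewrite lerXn2r ?nnegrE//; lra.
  by apply: (expr_log2_decay _ _ d0 hT); lra.
apply: (@le_trans _ _ (1 - 1 * E ^+ T)).
  by rewrite mul1r lerB// (le_trans hET dle).
rewrite -repeatC_prod//; apply: repeatC_mono => // cs sz.
rewrite mul1r; case: ifPn => hp.
  rewrite lerBlDr lerDl prodr_ge0// => c _.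
  by apply: le_trans (f1 c); rewrite invr_ge0 (le_trans ler01).
rewrite subr_le0; apply: (@prod_ge1_of_count _ f bad (9 / 5)) => //.
rewrite leqNgt; apply: contraNN hp => hc; apply: hP.
by apply: median_good hc; rewrite sz.
Qed.

(** * Relative variance of the surprisal *)

(** If [p * M > 1], the surprisal [X] is at most [L]. Otherwise [X - L] is the logarithm of
    [z = 1 / (p * M) >= 1]; expand [X * (X - L) = L * (X - L) + (X - L) ^+ 2] and bound both terms
    linearly in [z]. *)
Lemma sqr_log2_truncation (R : realType) (p M : R) :
  0 <= p <= 1 -> 1 <= M ->
  p * log2 (1 / p) ^+ 2 <=
  log2 M * (p * log2 (1 / p)) + (3 / 4 * log2 M + 9 / 4) / M.
Proof.
move=> /andP[p0 p1] M1; have M0 : 0 < M by lra.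
have L0 := log2_ge0 M1; set L := log2 M in L0 *.
have c0 : 0 <= (3 / 4 * L + 9 / 4) / M by apply: divr_ge0; lra.
move: p0; rewrite le_eqVlt => /orP[/eqP <-|p0].
  by rewrite !mul0r mulr0 add0r.
have X0 : 0 <= log2 (1 / p) by rewrite log2_ge0// ler_pdivlMr// mul1r.
have XL : log2 (1 / (p * M)) = log2 (1 / p) - L.
  by rewrite !log2V ?mulr_gt0// log2M// opprD.
set X := log2 (1 / p) in X0 XL *.
have [pM|pM] := leP (p * M) 1; last first.
  have XleL : X <= L.
    by apply: ler_log2; rewrite ?divr_gt0// ler_pdivrMr// mulrC ltW.
  suff : p * X * (X - L) <= 0 by move=> h; nra.
  by rewrite mulr_ge0_le0 ?subr_le0 ?(mulr_ge0 (ltW p0) X0).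
have z1 : 1 <= 1 / (p * M) by rewrite ler_pdivlMr ?mulr_gt0// mul1r.
have := log2_le_linear z1; have := sqr_log2_le_linear z1; rewrite XL => h2 h1.
have g1 : p * (X - L) <= 3 / 4 / M.
  have -> : 3 / 4 / M = p * (3 / 4 * (1 / (p * M))) by field; rewrite !gt_eqF.
  by rewrite ler_pM2l.
have g2 : p * (X - L) ^+ 2 <= 9 / 4 / M.
  have -> : 9 / 4 / M = p * (9 / 4 * (1 / (p * M))) by field; rewrite !gt_eqF.
  by rewrite ler_pM2l.
have g3 : L * (p * (X - L)) <= L * (3 / 4 / M) by rewrite ler_wpM2l.
rewrite mulrDl -[3 / 4 * L]mulrC -[L * (3 / 4) / M]mulrA.
rewrite -lerBlDl; apply: le_trans (lerD g3 g2).
by rewrite le_eqVlt; apply/orP; left; apply/eqP; ring.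
Qed.

(** Truncation at [M = #|Omega| * A]: at most [#|Omega|] points each pay an error of order [1 / M],
    so the total error is of order [1 / A]. *)
Lemma second_moment_le (R : realType) (Omega : finType) (S : {set Omega})
    (w : Omega -> R) (A : R) :
  (forall x, x \in S -> 0 <= w x <= 1) -> 1 <= A -> (0 < #|Omega|)%N ->
  \sum_(x in S) w x * log2 (1 / w x) ^+ 2 <=
  log2 (#|Omega|%:R * A) * \sum_(x in S) w x * log2 (1 / w x) +
  (3 / 4 * log2 (#|Omega|%:R * A) + 9 / 4) / A.
Proof.
move=> hw A1 N0; set N : R := #|Omega|%:R.
have N1 : 1 <= N by rewrite ler1n.
have M1 : 1 <= N * A by nra.
have L0 := log2_ge0 M1; set L := log2 (N * A) in L0 *.
set c := 3 / 4 * L + 9 / 4.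
have c0 : 0 <= c by rewrite /c; lra.
apply: (@le_trans _ _ (\sum_(x in S)
    (L * (w x * log2 (1 / w x)) + c / (N * A)))).
  by apply: ler_sum => x xS; apply: sqr_log2_truncation => //; apply: hw.
rewrite big_split/= -mulr_sumr lerD2l sumr_const -mulr_natl.
have -> : c / A = N * (c / (N * A)) by field; rewrite !gt_eqF//; lra.
rewrite ler_wpM2r ?divr_ge0//; first by lra.
by rewrite ler_nat max_card.
Qed.

Lemma weighted_var (R : realType) (Omega : finType) (S : {set Omega})
    (w Y : Omega -> R) :
  \sum_(x in S) w x = 1 ->
  \sum_(x in S) w x * (Y x - \sum_(y in S) w y * Y y) ^+ 2 =
  \sum_(x in S) w x * Y x ^+ 2 - (\sum_(x in S) w x * Y x) ^+ 2.
Proof.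
move=> w1; set h := \sum_(x in S) w x * Y x.
transitivity (\sum_(x in S) (w x * Y x ^+ 2 +
    (w x * Y x * (- (2 * h)) + w x * h ^+ 2))).
  by apply: eq_bigr => x _; ring.
by rewrite !big_split/= -!mulr_suml w1 -/h; ring.
Qed.

Lemma entropyE (R : realType) (Omega : finType) (D : Omega -> R) :
  entropy D = \sum_x D x * log2 (1 / D x).
Proof. by apply: eq_bigr => x _; case: eqP => // ->; rewrite mul0r. Qed.

Lemma ler_prob1 (R : realType) (Omega : finType) (D : Omega -> R) (x : Omega) :
  (forall x, 0 <= D x) -> \sum_x D x = 1 -> D x <= 1.
Proof. by move=> D0 <-; rewrite (bigD1 x)//= lerDl sumr_ge0. Qed.

Lemma card_gt0_mOmega (R : realType) (Omega : finType) :
  2 <= mOmega R Omega -> (0 < #|Omega|)%N.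
Proof.
rewrite /mOmega lt0n; apply: contraTneq => ->.
by rewrite -ltNge /log2 ln0// mul0r.
Qed.

Lemma log2_ge1 (R : realType) (m : R) : 2 <= m -> 1 <= log2 m.
Proof. by move=> hm; rewrite -(log2_2 R) ler_log2. Qed.

(** * The two branches *)

Lemma lightBranch_correct (R : realType) (Omega : finType) (D : Omega -> R)
    (eps delta : R) :
  (forall x, 0 <= D x) -> \sum_x D x = 1 -> 2 <= mOmega R Omega ->
  0 < eps -> 0 < delta < 1 -> (forall x, D x <= 1 / 2) ->
  1 - 9 / 10 * delta <= lightBranch D eps delta (fun h =>
    if ((1 - eps) * entropy D <= h) && (h <= (1 + eps) * entropy D)
    then 1 else 0).
Proof.
move=> D0 D1 hm e0 /andP[d0 d1] Dhalf; rewrite /lightBranch.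
have N0 := card_gt0_mOmega hm; have NR : 0 < #|Omega|%:R :> R by rewrite ltr0n.
have lm := log2_ge1 hm.
set A := _ + _ + 11 / 10; have hA : 41 / 10 <= A by rewrite /A; lra.
have A0 : 0 < A by lra.
have A1 : 1 <= A by lra.
have lA : 2 <= log2 A by rewrite -(log2_4 R) ler_log2//; lra.
have -> : mOmega R Omega + log2 A = log2 (#|Omega|%:R * A) by rewrite log2M.
have hL : 4 <= log2 (#|Omega|%:R * A).
  by rewrite log2M// -/(mOmega R Omega); lra.
set L := log2 (_ * A) in hL *; set t := Defs.ceilN _.
have sumT (F : Omega -> R) : \sum_(x in ~: finset.set0) F x = \sum_x F x.
  by apply: eq_bigl => x; rewrite !inE.
have DS1 : \sum_(y in ~: finset.set0) D y = 1 by rewrite sumT.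
have muE : procMean D (~: finset.set0) = entropy D.
  rewrite /procMean DS1 sumT entropyE.
  by apply: eq_bigr => x _; rewrite divr1.
have H1 : 1 <= entropy D.
  rewrite entropyE -D1; apply: ler_sum => x _.
  have := D0 x; rewrite le_eqVlt => /orP[/eqP <-|Dx]; first by rewrite mul0r.
  rewrite ler_peMr// -(log2_2 R) ler_log2// ler_pdivlMr//.
  by have := Dhalf x; lra.
set H := entropy D in muE H1 *.
have VE : procVar D (~: finset.set0) =
    \sum_(x in ~: finset.set0) D x * log2 (1 / D x) ^+ 2 - H ^+ 2.
  rewrite -muE /procVar /procMean DS1.
  under eq_bigr do rewrite divr1.
  under [X in _ - X ^+ 2]eq_bigr do rewrite divr1.
  rewrite -weighted_var//; apply: eq_bigr => x _; congr (_ * (_ - _) ^+ 2).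
  by apply: eq_bigr => y _; rewrite divr1.
have V1 : procVar D (~: finset.set0) <= 36 / 25 * (L - 1) * H ^+ 2.
  have := @second_moment_le R Omega (~: finset.set0) D A.
  rewrite -/L (sumT (fun x => D x * log2 (1 / D x))) -entropyE -/H => h.
  have {}h := h
    (fun x _ => introT andP (conj (D0 x) (ler_prob1 x D0 D1))) A1 N0.
  (* [44 / 100 = 36 / 25 - 1]: the remaining [L - 1] comes from [L * H <= L * H ^+ 2] and the
     subtracted [H ^+ 2]. The bound uses [A >= 41 / 10] and [L >= 4]. *)
  have cle : (3 / 4 * L + 9 / 4) / A <= 44 / 100 * (L - 1).
    by rewrite ler_pdivrMr//; nra.
  rewrite VE; move: h; set Q := \sum_(x in _) _ => h.
  have h1 : L * H <= L * H ^+ 2 by rewrite ler_wpM2l; nra.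
  have h2 : 44 / 100 * (L - 1) <= 44 / 100 * (L - 1) * H ^+ 2.
    by rewrite ler_peMr; nra.
  lra.
have targ : 0 < 6 / eps ^+ 2 * (L - 1).
  by rewrite mulr_gt0 ?divr_gt0 ?exprn_gt0//; lra.
have ht : 6 / eps ^+ 2 * (L - 1) <= t%:R by apply: ceilN_ge; exact: ltW.
have te : 6 * (L - 1) <= t%:R * eps ^+ 2.
  by move: ht; rewrite mulrAC ler_pdivrMr ?exprn_gt0.
apply: (@SampleEst_correct _ _ _ _ _ _ (eps * H)) => //.
- by rewrite DS1.
- by rewrite -(ltr_nat R); apply: lt_le_trans ht.
- by lra.
- by lra.
- by rewrite mulr_gt0//; lra.
(* The constants match because [36 / 25 = 6 * (6 / 25)], with the [6] supplied by the choice of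
   [t]. *)
- apply: le_trans V1 _; rewrite exprMn.
  have -> : 6 / 25 * t%:R * (eps ^+ 2 * H ^+ 2) =
    6 / 25 * (t%:R * eps ^+ 2) * H ^+ 2 by ring.
  rewrite ler_wpM2r ?sqr_ge0//; lra.
- by move=> h; rewrite muE mulrBl mulrDl mul1r.
Qed.

Lemma heavyBranch_correct (R : realType) (Omega : finType) (D : Omega -> R)
    (eps delta : R) (x : Omega) :
  (forall x, 0 <= D x) -> \sum_x D x = 1 -> 2 <= mOmega R Omega ->
  0 < eps -> 0 < delta < 1 -> 1 / 2 < D x ->
  1 - 9 / 10 * delta <= heavyBranch D eps delta x (D x) (fun h =>
    if ((1 - eps) * entropy D <= h) && (h <= (1 + eps) * entropy D)
    then 1 else 0).
Proof.
move=> D0 D1 hm e0 /andP[d0 d1] Dx; rewrite /heavyBranch.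
have sumD (F : Omega -> R) : \sum_y F y = F x + \sum_(y in ~: [set x]) F y.
  rewrite (bigD1 x)//=; congr (_ + _); apply: eq_bigl => y.
  by rewrite !inE.
have DS : \sum_(y in ~: [set x]) D y = 1 - D x by rewrite -D1 sumD; ring.
have Dx1 : D x <= 1 by exact: ler_prob1.
(* At mass one all other points have mass zero, so the entropy is [0], the value returned. *)
case: eqVneq => [Dx1E|Dxn1].
  have -> : entropy D = 0.
    rewrite entropyE sumD Dx1E divr1 log2_1 mulr0 add0r big1// => y yS.
    suff -> : D y = 0 by rewrite mul0r.
    apply/eqP; move: DS; rewrite Dx1E subrr => /eqP.
    by rewrite psumr_eq0// => /allP/(_ y (mem_index_enum _)); rewrite yS.
  by rewrite !mulr0 lexx/=; lra.
have {Dxn1}Dx1 : D x < 1 by rewrite lt_neqAle Dxn1.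
have N0 := card_gt0_mOmega hm; have NR : 0 < #|Omega|%:R :> R by rewrite ltr0n.
have lm := log2_ge1 hm.
set A := _ + _ + 5 / 2; have hA : 11 / 2 <= A by rewrite /A; lra.
have A0 : 0 < A by lra.
have A1 : 1 <= A by lra.
have lA : 2 <= log2 A by rewrite -(log2_4 R) ler_log2//; lra.
have -> : mOmega R Omega + log2 A = log2 (#|Omega|%:R * A) by rewrite log2M.
have hL : 4 <= log2 (#|Omega|%:R * A).
  by rewrite log2M// -/(mOmega R Omega); lra.
set L := log2 (_ * A) in hL *; set t := Defs.ceilN _.
set S := ~: [set x] in sumD DS *; set r := D x in Dx Dx1 DS *.
have q0 : 0 < 1 - r by lra.
pose w y := D y / (1 - r); pose Y y := log2 (1 / w y).
pose l := log2 (1 / (1 - r)).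
have l1 : 1 <= l.
  by rewrite /l -[leLHS](log2_2 R) ler_log2// ler_pdivlMr//; lra.
have w1 : \sum_(y in S) w y = 1 by rewrite -mulr_suml DS divff// gt_eqF.
have w0 y : 0 <= w y by rewrite divr_ge0// ltW.
(* The shift identity can fail at a point of mass zero, where the logarithms take default values,
   but there the weight vanishes. *)
have wX y : w y = 0 \/ log2 (1 / D y) = Y y + l.
  have := D0 y; rewrite le_eqVlt => /orP[/eqP Dy|Dy].
    by left; rewrite /w -Dy mul0r.
  right; rewrite /Y /l -log2M ?divr_gt0//; congr log2.
  by rewrite /w; field; rewrite !gt_eqF.
have wY y : w y * log2 (1 / D y) = w y * (Y y + l).
  by case: (wX y) => ->; rewrite ?mul0r.
set h := \sum_(y in S) w y * Y y.
have muE : procMean D S = h + l.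
  rewrite /procMean DS; under eq_bigr => y _ do rewrite -/(w y) wY mulrDr.
  by rewrite big_split/= -mulr_suml w1 mul1r.
have VE : procVar D S = \sum_(y in S) w y * Y y ^+ 2 - h ^+ 2.
  rewrite -weighted_var// /procVar muE DS -/h; apply: eq_bigr => y _.
  rewrite -/(w y); case: (wX y) => ->; first by rewrite !mul0r.
  by congr (_ * _ ^+ 2); ring.
have HE : entropy D = r * log2 (1 / r) + (1 - r) * (h + l).
  rewrite entropyE sumD -muE /procMean DS mulr_sumr; congr (_ + _).
  by apply: eq_bigr => y _; field; rewrite gt_eqF.
have w01 y : y \in S -> 0 <= w y <= 1.
  by move=> yS; rewrite w0/= -w1 (bigD1 y)//= lerDl sumr_ge0.
have h0 : 0 <= h.
  apply: sumr_ge0 => y /w01 /andP[wy0 wy1].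
  move: wy0; rewrite le_eqVlt => /orP[/eqP <-|wy0]; first by rewrite mul0r.
  by rewrite mulr_ge0 ?(ltW wy0)// log2_ge0// ler_pdivlMr// mul1r.
have V1 : procVar D S <= 36 / 25 * L * (h + l) ^+ 2.
  have := @second_moment_le R Omega S w A w01 A1 N0; rewrite -/L -/h => hQ.
  have cle : (3 / 4 * L + 9 / 4) / A <= 36 / 25 * L.
    by rewrite ler_pdivrMr//; nra.
  (* The shift [l >= 1] plays the role that entropy at least one plays in the light case, as [h]
     itself may be near [0]. *)
  have hl : 1 + h <= (h + l) ^+ 2 by nra.
  have {}hl : 36 / 25 * L * (1 + h) <= 36 / 25 * L * (h + l) ^+ 2.
    by rewrite ler_wpM2l//; lra.
  have Lh : 0 <= L * h by rewrite mulr_ge0//; lra.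
  rewrite VE (le_trans _ hl)// lerBlDr (le_trans hQ)//.
  by have := sqr_ge0 h; rewrite mulrDr; lra.
have rl0 : 0 <= r * log2 (1 / r).
  rewrite mulr_ge0//; first by lra.
  by rewrite log2_ge0// ler_pdivlMr; lra.
set H := entropy D in HE *.
have H0 : 0 < H by rewrite HE ltr_wpDl// mulr_gt0//; lra.
have L0 : 0 < L by lra.
have targ : 0 < 6 / eps ^+ 2 * L.
  by rewrite (mulr_gt0 _ L0)// divr_gt0 ?exprn_gt0.
have ht : 6 / eps ^+ 2 * L <= t%:R by apply: ceilN_ge; exact: ltW.
have te : 6 * L <= t%:R * eps ^+ 2.
  by move: ht; rewrite mulrAC ler_pdivrMr ?exprn_gt0.
have qB : (1 - r) * (eps * (H / (1 - r))) = eps * H by field; rewrite gt_eqF.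
(* The output scales the estimate by [1 - r], so this tolerance becomes [eps * H]. *)
apply: (@SampleEst_correct _ _ _ _ _ _ (eps * (H / (1 - r)))
  (fun z => ((1 - eps) * H <= (1 - r) * z + r * log2 (1 / r)) &&
            ((1 - r) * z + r * log2 (1 / r) <= (1 + eps) * H))) => //.
- by rewrite DS.
- by rewrite -(ltr_nat R); apply: lt_le_trans ht.
- by lra.
- by lra.
- by rewrite mulr_gt0// divr_gt0.
- apply: le_trans V1 _; rewrite exprMn.
  have -> : 6 / 25 * t%:R * (eps ^+ 2 * (H / (1 - r)) ^+ 2) =
    6 / 25 * (t%:R * eps ^+ 2) * (H / (1 - r)) ^+ 2 by ring.
  apply: ler_pM; [by lra|by rewrite sqr_ge0|by lra|].
  rewrite lerXn2r ?nnegrE//; [by lra|by rewrite ltW// divr_gt0|].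
  by rewrite ler_pdivlMr// HE mulrC lerDr.
- move=> z /andP[]; rewrite muE => z1 z2.
  have u1 : (1 - r) * (h + l) - eps * H <= (1 - r) * z.
    by rewrite -qB -mulrBr ler_pM2l.
  have u2 : (1 - r) * z <= (1 - r) * (h + l) + eps * H.
    by rewrite -qB -mulrDr ler_pM2l.
  by apply/andP; split; lra.
Qed.

(** * Searching for the heavy element *)

Lemma rounds_light (R : realType) (Omega : finType) (D : Omega -> R)
    (eps delta : R) (n : nat) (k : R -> R) :
  \sum_x D x = 1 -> (forall x, D x <= 1 / 2) ->
  rounds D eps delta n k = lightBranch D eps delta k.
Proof.
move=> D1 Dhalf; elim: n => [//|n IH] /=; rewrite /PROC.
have DT : \sum_(y in [set: Omega]) D y = 1.
  by rewrite -D1; apply: eq_bigl => x; rewrite inE.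
under eq_bigr => x _ do rewrite ltNge Dhalf/= IH DT divr1.
by rewrite -mulr_suml DT mul1r.
Qed.

(** No other point can exceed [1 / 2], so each round either draws [x] and enters the heavy branch
    or, with probability [1 - D x], passes to the next round. *)
Lemma rounds_heavy (R : realType) (Omega : finType) (D : Omega -> R)
    (eps delta v : R) (n : nat) (k : R -> R) (x : Omega) :
  (forall x, 0 <= D x) -> \sum_x D x = 1 -> 1 / 2 < D x ->
  0 <= v <= heavyBranch D eps delta x (D x) k ->
  0 <= lightBranch D eps delta k ->
  (1 - (1 - D x) ^+ n) * v <= rounds D eps delta n k.
Proof.
move=> D0 D1 Dx /andP[v0 vh] lb; elim: n => [|n IH] /=.
  by rewrite expr0 subrr mul0r.
have sumD : \sum_(y | y != x) D y = 1 - D x.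
  by rewrite -[in RHS]D1 [in RHS](bigD1 x)//= [RHS]addrC addKr.
have Dy y : y != x -> D y <= 1 / 2.
  move=> yx; have : D y <= \sum_(y | y != x) D y.
    by rewrite (bigD1 y)//= lerDl sumr_ge0.
  by rewrite sumD; lra.
have DT : \sum_(y in [set: Omega]) D y = 1.
  by rewrite -D1; apply: eq_bigl => y; rewrite inE.
rewrite /PROC DT (bigD1 x) ?inE//= Dx divr1.
have -> : \sum_(y in [set: Omega] | y != x) D y / 1 *
   (if 1 / 2 < D y then heavyBranch D eps delta y (D y) k
    else rounds D eps delta n k) = (1 - D x) * rounds D eps delta n k.
  rewrite -sumD mulr_suml; apply: eq_big => y; first by rewrite inE.
  by move=> /andP[_ yx]; rewrite ltNge Dy//= divr1.
have qI : (1 - D x) * ((1 - (1 - D x) ^+ n) * v) <=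
    (1 - D x) * rounds D eps delta n k.
  by rewrite ler_wpM2l// subr_ge0 ler_prob1.
have qh : D x * v <= D x * heavyBranch D eps delta x (D x) k.
  by rewrite ler_wpM2l.
apply: le_trans (lerD qh qI); rewrite exprS le_eqVlt; apply/orP; left.
by apply/eqP; ring.
Qed.

Lemma SampleEst_ge0 (R : realType) (Omega : finType) (D : Omega -> R)
    (Sbar : {set Omega}) (t : nat) (d : R) (k : R -> R) :
  (forall x, 0 <= D x) -> (forall h, 0 <= k h) -> 0 <= SampleEst D Sbar t d k.
Proof.
move=> D0 k0; rewrite /SampleEst.
have sum0 (u : nat) (g : R -> R) :
    (forall s, 0 <= g s) -> 0 <= sumLogQueries D (~: Sbar) u g.
  elim: u g => [|u IH] g g0 //=; apply: sumr_ge0 => x _.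
  by rewrite mulr_ge0 ?IH// divr_ge0// sumr_ge0.
set T := Defs.ceilN _; pose g cs := k (median cs).
have : forall cs, 0 <= g cs by move=> cs; apply: k0.
by rewrite -/g; elim: T g => [|T IH] g g0 //=; apply: sum0 => s; apply: IH.
Qed.

Lemma half_pow_ceil_log2 (R : realType) (z : R) :
  1 <= z -> (1 / 2) ^+ Defs.ceilN (log2 z) <= z^-1.
Proof.
move=> z1; set n := Defs.ceilN _; have z0 : 0 < z by lra.
have hn : log2 z <= n%:R by apply/ceilN_ge/log2_ge0.
rewrite div1r exprVn lef_pV2 ?posrE ?exprn_gt0//.
rewrite -ler_ln ?posrE ?exprn_gt0// lnXn// -[ln 2 *+ n]mulr_natl.
by rewrite -ler_pdivrMr// ln2_gt0.
Qed.

Unset Implicit Arguments.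
Set Strict Implicit.

Theorem mainTheorem4 (R : realType) (Omega : finType) (D : Omega -> R)
  (eps delta : R)
  (hD0 : forall x, 0 <= D x)
  (hD1 : \sum_(x : Omega) D x = 1)
  (hm : 2 <= mOmega R Omega)
  (heps : 0 < eps)
  (hdelta : 0 < delta < 1) :
  1 - delta <=
  PrEE D eps delta
    (fun h => ((1 - eps) * entropy D <= h) && (h <= (1 + eps) * entropy D)).
Proof.
have /andP[d0 d1] := hdelta.
(* Budget: [delta / 10] for missing the heavy point, [9 / 10 * delta] for the estimate. *)
have dd : 1 - delta <= (1 - delta / 10) * (1 - 9 / 10 * delta).
  by have := sqr_ge0 delta; lra.
have v0 : 0 <= 1 - 9 / 10 * delta by lra.
rewrite /PrEE /EntropyEstimation; set n := Defs.ceilN _.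
set k := (X in rounds _ _ _ _ X).
have [/existsP[x Dx]|/existsPn light] := boolP [exists x, 1 / 2 < D x];
    last first.
  have Dhalf x : D x <= 1 / 2 by rewrite leNgt.
  rewrite rounds_light//.
  apply: le_trans (lightBranch_correct _ _ _ _ _ _) => //.
  by lra.
have hb := heavyBranch_correct hD0 hD1 hm heps hdelta Dx.
have lb : 0 <= lightBranch D eps delta k.
  by apply: SampleEst_ge0 => // h; rewrite /k; case: ifP.
have := @rounds_heavy _ _ D eps delta (1 - 9 / 10 * delta) n k x hD0 hD1 Dx.
rewrite v0 hb => /(_ isT lb); apply: le_trans.
have pn : (1 - D x) ^+ n <= delta / 10.
  apply: (@le_trans _ _ ((1 / 2) ^+ n)).
    by rewrite lerXn2r ?nnegrE//; have := ler_prob1 x hD0 hD1; lra.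
  have -> : delta / 10 = (10 / delta)^-1 by rewrite invf_div.
  by apply: half_pow_ceil_log2; rewrite ler_pdivlMr//; lra.
exact: le_trans dd (ler_wpM2r v0 (lerB (lexx 1) pn)).
Qed.
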